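(* For $\beta_1,\beta_2\in\mathbb{R}$ let $T(h)=\beta_1\,t(H_1,h)+\beta_2\,t(H_2,h)$ for $h\in\mathcal{W}$, where $H_1$ is a single edge and $H_2$ is a triangle. Then for any given value of $\beta_1$, there is a positive constant $C(\beta_1)$ sufficiently large so that whenever $\beta_2<-C(\beta_1)$, $T(h)-I(h)$ is not maximized over $\mathcal{W}$ at any constant function. Consequently, for such $\beta_1,\beta_2$, if $G_n$ is an $n$-vertex exponential random graph with this sufficient statistic, i.e. a random element of $\mathcal{G}_n$ with $\mathbb{P}(G_n=G)=e^{n^2(T(\widetilde{G})-\psi_n)}$ ($\psi_n$ the normalizing constant), then there exists $\varepsilon>0$ such that $$\lim_{n\to\infty}\mathbb{P}\bigl(\delta_\Box(\widetilde{G}_n,\widetilde{C})>\varepsilon\bigr)=1,$$ where $\widetilde{C}\subseteq\widetilde{\mathcal{W}}$ is the set of (classes of) constant functions.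
   Context: $\mathcal{G}_n$ is the set of all simple graphs (undirected, no loops, no multiple edges) on the vertex set $\{1,\dots,n\}$. $\mathcal{W}$ is the set of all measurable functions $h:[0,1]^2\to[0,1]$ with $h(x,y)=h(y,x)$. The cut distance on $\mathcal{W}$ is $d_\Box(f,g)=\sup_{S,A\subseteq[0,1]}\left|\int_{S\times A}[f(x,y)-g(x,y)]\,dx\,dy\right|$ (supremum over measurable sets). Let $\Sigma$ be the set of measure-preserving bijections $\sigma:[0,1]\to[0,1]$ and write $g_\sigma(x,y)=g(\sigma x,\sigma y)$. For $g\in\mathcal{W}$, $\widetilde{g}$ denotes the closure in $(\mathcal{W},d_\Box)$ of the orbit $\{g_\sigma:\sigma\in\Sigma\}$; $\widetilde{\mathcal{W}}$ is the resulting quotient space, with metric $\delta_\Box(\widetilde{f},\widetilde{g})=\inf_{\sigma\in\Sigma}d_\Box(f,g_\sigma)$; the distance from a point to a set is the infimum of the distances to its elements. $t(H_1,h)=\iint h(x,y)\,dx\,dy$ and $t(H_2,h)=\iiint h(x,y)h(y,z)h(z,x)\,dx\,dy\,dz$ (integrals over $[0,1]$ in each variable). For a simple graph $G$ on $\{1,\dots,n\}$, $f^G\in\mathcal{W}$ is defined by $f^G(x,y)=1$ if $(\lceil nx\rceil,\lceil ny\rceil)$ is an edge of $G$ and $0$ otherwise; $\widetilde{G}:=\widetilde{f^G}$, and $T(\widetilde{G})=T(f^G)=2\beta_1\frac{\#\text{edges in }G}{n^2}+6\beta_2\frac{\#\text{triangles in }G}{n^3}$. The normalizing constant is $\psi_n=\frac1{n^2}\log\sum_{G\in\mathcal{G}_n}e^{n^2T(\widetilde{G})}$.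 $I(u)=\frac12u\log u+\frac12(1-u)\log(1-u)$ for $u\in[0,1]$ ($0\log0=0$), and $I(h)=\iint_{[0,1]^2}I(h(x,y))\,dx\,dy$ for $h\in\mathcal{W}$. *)

(* Defs.v *)
From HB Require Import structures.
From mathcomp Require Import all_boot all_order all_algebra.
From mathcomp Require Import all_classical all_reals all_analysis.

Set Implicit Arguments.
Unset Strict Implicit.
Unset Printing Implicit Defensive.

Import Order.TTheory GRing.Theory Num.Theory.
Import numFieldNormedType.Exports.

Local Open Scope classical_set_scope.
Local Open Scope ring_scope.

Record simple_graph (n : nat) := SimpleGraph {
  edges : {set {set 'I_n}};
  _ : [forall e in edges, #|e| == 2%N]
}.

HB.instance Definition _ (n : nat) := [isSub for @edges n].
HB.instance Definition _ (n : nat) := [Finite of simple_graph n by <:].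

Definition unit_interval (R : realType) : set R := `[0, 1].
Arguments unit_interval : clear implicits.

Local Notation leb R := (@lebesgue_measure R).
Local Notation leb2 R := (leb R \x leb R)%E.

(* Functions on [0,1]^2 are represented by functions on R * R of which only
   the values on the unit square matter. *)
Definition graphon (R : realType) : set (R * R -> R) :=
  [set h : R * R -> R |
    [/\ measurable_fun (unit_interval R `*` unit_interval R) h,
     (forall x y, unit_interval R x -> unit_interval R y ->
        0 <= h (x, y) <= 1) &
     (forall x y, unit_interval R x -> unit_interval R y ->
        h (x, y) = h (y, x))]].
Arguments graphon : clear implicits.

Definition cut_dist (R : realType) (f g : R * R -> R) : R :=
  sup [set r | exists S A : set R,
    [/\ measurable S, measurable A,
        S `<=` unit_interval R, A `<=` unit_interval R &
        r = `| \int[leb2 R]_(p in S `*` A) (f p - g p) |]].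

Definition mp_bijection (R : realType) : set (R -> R) :=
  [set sigma : R -> R | [/\ set_bij (unit_interval R) (unit_interval R) sigma,
     measurable_fun (unit_interval R) sigma &
     forall A : set R, measurable A -> A `<=` unit_interval R ->
       leb R (unit_interval R `&` sigma @^-1` A) = leb R A]].
Arguments mp_bijection : clear implicits.

Definition relabel (R : realType) (g : R * R -> R) (sigma : R -> R) :
    R * R -> R :=
  fun p => g (sigma p.1, sigma p.2).

(* The class of g: the closure of its orbit for the cut distance. *)
Definition tilde (R : realType) (g : R * R -> R) : set (R * R -> R) :=
  [set f | graphon R f /\
     forall eps : R, 0 < eps ->
       exists2 sigma, mp_bijection R sigma &
         cut_dist f (relabel g sigma) < eps].

Definition delta_cut_fun (R : realType) (f g : R * R -> R) : R :=
  inf [set cut_dist f (relabel g sigma) | sigma in mp_bijection R].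

(* The metric on classes. The value of delta_cut_fun does not depend on the
   representatives, so the outer infimum is over a one-element set. *)
Definition delta_cut (R : realType) (F G : set (R * R -> R)) : R :=
  inf [set r | exists f g : R * R -> R,
    [/\ graphon R f, graphon R g, tilde f = F, tilde g = G &
        r = delta_cut_fun f g]].

Definition delta_cut_set (R : realType) (F : set (R * R -> R))
    (K : set (set (R * R -> R))) : R :=
  inf [set delta_cut F G | G in K].

Definition constant_classes (R : realType) : set (set (R * R -> R)) :=
  [set tilde (fun=> c) | c in unit_interval R].
Arguments constant_classes : clear implicits.

Definition t_edge (R : realType) (h : R * R -> R) : R :=
  \int[leb2 R]_(p in unit_interval R `*` unit_interval R) h p.

Definition t_triangle (R : realType) (h : R * R -> R) : R :=
  \int[leb R]_(x in unit_interval R)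
    \int[leb R]_(y in unit_interval R)
      \int[leb R]_(z in unit_interval R) (h (x, y) * h (y, z) * h (z, x)).

Definition T_stat (R : realType) (beta1 beta2 : R) (h : R * R -> R) : R :=
  beta1 * t_edge h + beta2 * t_triangle h.

(* ln 0 = 0 in the library, which gives 0 * ln 0 = 0. *)
Definition entropy (R : realType) (u : R) : R :=
  2^-1 * u * ln u + 2^-1 * (1 - u) * ln (1 - u).

Definition I_fun (R : realType) (h : R * R -> R) : R :=
  \int[leb2 R]_(p in unit_interval R `*` unit_interval R)
    entropy (h p).

(* The vertex set {1, ..., n} is 'I_n, with i : 'I_n standing for i + 1. *)
Definition graph_fun (R : realType) (n : nat) (G : simple_graph n) :
    R * R -> R :=
  fun p => [exists i : 'I_n, exists j : 'I_n,
    [&& Num.ceil (n%:R * p.1) == Posz i.+1,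
        Num.ceil (n%:R * p.2) == Posz j.+1 &
        [set i; j]%SET \in edges G]]%:R.
Arguments graph_fun R {n} G.

Definition psi (R : realType) (beta1 beta2 : R) (n : nat) : R :=
  (n%:R ^+ 2)^-1 *
  ln (\sum_(G : simple_graph n)
        expR (n%:R ^+ 2 * T_stat beta1 beta2 (graph_fun R G))).

(* Main.v *)
Require Import Defs.
From mathcomp Require Import all_boot all_order all_algebra.
From mathcomp Require Import all_classical all_reals all_analysis.
From mathcomp Require Import measurable_realfun.
From mathcomp Require Import ring lra zify.

Set Implicit Arguments.
Unset Strict Implicit.
Unset Printing Implicit Defensive.

Import Order.TTheory GRing.Theory Num.Theory.
Import numFieldNormedType.Exports.

Local Open Scope classical_set_scope.
Local Open Scope ring_scope.

(** Write p = exp (2 beta1) and L = ln (1 + p) > 0.  When beta2 is very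
    negative, triangles are so expensive that a good competitor should have
    none.  A bipartite graphon, equal to v across two halves and to 0 inside
    them, has no triangle at all; with v = p / (1 + p), Gibbs' variational
    principle ([gibbs_eq]) gives it the value L / 4, whatever beta2 is
    ([bipartite_value]).  A constant c instead pays beta2 c^3.  Once
    beta2 < - a^3 / d^2, the cubic lies below the line d - a c on the
    nonnegative half-line ([cubic_le_linear]), so the penalty is at least as bad
    as replacing beta1 by beta1 - a, up to the error d, and Gibbs' inequality
    bounds the value by 1/2 ln (1 + p exp (- 2 a)) + d
    ([constant_value_ub]).  Taking a large and d = L / 32 makes this smaller
    than L / 4: no constant is a maximizer.

    For finite graphs the same comparison is made by direct counting.  The
    graphs contained in a balanced complete bipartite graph alone contribute
    (1 + p)^(number of crossing pairs), about exp (n^2 L / 4), to the partition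
    function ([partition_function_lb]).  If f^G is within cut distance e of the
    constants, its triangle density is at least the cube of its edge density
    minus 12 e ([near_constant_triangle_lb]); hence its weight is at most
    exp (n^2 (d + 12 e |beta2|)) (p exp (- 2 a))^(number of edges)
    ([near_constant_weight]).  Summing this over all graphs by the binomial
    formula gives at most exp (3 n^2 L / 32) for small e, exponentially less
    than the partition function ([near_constant_ratio]).

    The analytic ingredient is the counting lemma: the edge and triangle
    densities are Lipschitz for the cut distance ([t_edge_cut_dist],
    [t_triangle_cut_dist]).  It is combined with the fact that the densities
    are unchanged by relabeling, a change of variables ([t_edge_relabel],
    [t_triangle_relabel]).  Together they transfer the densities along the chain
    of representatives behind the distance between two classes
    ([delta_cut_densities]). *)

(** * Bounded measurable functions *)

(** On a space of finite measure these functions are integrable, and they are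
    closed under all the operations below, so a single predicate discharges
    every integrability side condition. *)
Definition bmeas d (T : measurableType d) (R : realType) (f : T -> R) :=
  measurable_fun setT f /\ exists M, forall x, `|f x| <= M.

Section bounded_measurable.
Context d (T : measurableType d) (R : realType).
Implicit Types f g : T -> R.

Lemma bmeas_cst (c : R) : bmeas (fun _ : T => c).
Proof. by split => //; exists `|c|. Qed.

Lemma bmeasD f g : bmeas f -> bmeas g -> bmeas (fun x => f x + g x).
Proof.
move=> [mf [M fM]] [mg [N gN]]; split; first exact: measurable_funD.
by exists (M + N) => x; rewrite (le_trans (ler_normD _ _))// lerD.
Qed.

Lemma bmeasM f g : bmeas f -> bmeas g -> bmeas (fun x => f x * g x).
Proof.
move=> [mf [M fM]] [mg [N gN]]; split; first exact: measurable_funM.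
by exists (M * N) => x; rewrite normrM ler_pM.
Qed.

Lemma bmeasN f : bmeas f -> bmeas (fun x => - f x).
Proof.
move=> [mf [M fM]]; split; first exact: measurableT_comp.
by exists M => x; rewrite normrN.
Qed.

Lemma bmeasB f g : bmeas f -> bmeas g -> bmeas (fun x => f x - g x).
Proof. by move=> bf bg; apply: bmeasD => //; exact: bmeasN. Qed.

Lemma bmeas_indic (A : set T) : measurable A -> bmeas (\1_A : T -> R).
Proof.
move=> mA; split; first exact: measurable_indic.
by exists 1 => x; rewrite indicE; case: (_ \in _); rewrite ?normr1// normr0.
Qed.

Lemma bmeas_comp d' (T' : measurableType d') (h : T' -> T) f :
  measurable_fun setT h -> bmeas f -> bmeas (fun x => f (h x)).
Proof.
move=> mh [mf [M fM]]; split; first exact: measurableT_comp.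
by exists M => x.
Qed.

End bounded_measurable.

(** * Integration over the unit interval *)

Definition E01 (R : realType) (f : R -> R) : R :=
  \int[@lebesgue_measure R]_(x in unit_interval R) f x.
Arguments E01 : clear implicits.

Section E01_theory.
Variable R : realType.
Implicit Types f g : R -> R.
Local Notation leb := (@lebesgue_measure R).
Local Notation D := (unit_interval R).
Local Notation E := (E01 R).

Lemma measurable_unit : measurable D.
Proof. exact: measurable_itv. Qed.

Lemma leb_unit : leb D = 1%E.
Proof. by rewrite /unit_interval lebesgue_measure_itv/= lte_fin ltr01 oppr0 adde0. Qed.

Lemma bmeas_integrable f : bmeas f -> leb.-integrable D (EFin \o f).
Proof.
move=> [mf [M fM]]; apply: measurable_bounded_integrable.
- exact: measurable_unit.
- by rewrite [X in (X < _)%E]leb_unit ltry.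
- exact: measurable_funTS.
- by exists M; split; rewrite ?num_real // => x Mx y _ /=; rewrite (le_trans (fM y))// ltW.
Qed.

Lemma EFin_E01 f : bmeas f -> (E f)%:E = (\int[leb]_(x in D) (f x)%:E)%E.
Proof.
move=> bf; rewrite /E01 /Rintegral fineK//.
by apply: integrable_fin_num; [exact: measurable_unit | exact: bmeas_integrable].
Qed.

Lemma eq_E01 f g : (forall x, D x -> f x = g x) -> E f = E g.
Proof. by move=> fg; apply: eq_Rintegral => x; rewrite inE => /fg. Qed.

Lemma E01D f g : bmeas f -> bmeas g -> E (fun x => f x + g x) = E f + E g.
Proof.
move=> bf bg; apply: RintegralD; [exact: measurable_unit | exact: bmeas_integrable..].
Qed.

Lemma E01B f g : bmeas f -> bmeas g -> E (fun x => f x - g x) = E f - E g.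
Proof.
move=> bf bg; apply: RintegralB; [exact: measurable_unit | exact: bmeas_integrable..].
Qed.

Lemma E01Z c f : bmeas f -> E (fun x => c * f x) = c * E f.
Proof.
by move=> bf; apply: RintegralZl; [exact: measurable_unit | exact: bmeas_integrable].
Qed.

Lemma E01_cst c : E (fun=> c) = c.
Proof.
rewrite /E01 Rintegral_cst; last exact: measurable_unit.
by rewrite [X in fine X]leb_unit mulr1.
Qed.

Lemma le_E01 f g : bmeas f -> bmeas g -> (forall x, D x -> f x <= g x) -> E f <= E g.
Proof.
move=> bf bg fg; rewrite /E01; apply: le_Rintegral => //;
  [exact: measurable_unit | exact: bmeas_integrable..].
Qed.

Lemma E01_le f c : bmeas f -> (forall x, D x -> f x <= c) -> E f <= c.
Proof.
by move=> bf fc; rewrite -[leRHS]E01_cst; apply: le_E01 => //; exact: bmeas_cst.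
Qed.

Lemma E01_ge f c : bmeas f -> (forall x, D x -> c <= f x) -> c <= E f.
Proof.
by move=> bf fc; rewrite -[leLHS]E01_cst; apply: le_E01 => //; exact: bmeas_cst.
Qed.

Lemma E01_norm f c : bmeas f -> (forall x, D x -> `|f x| <= c) -> `|E f| <= c.
Proof.
move=> bf fc; rewrite ler_norml; apply/andP; split.
  by apply: E01_ge => // x /fc; rewrite ler_norml => /andP[].
by apply: E01_le => // x /fc; rewrite ler_norml => /andP[].
Qed.

(** Tonelli's theorem makes partial integrals of nonnegative functions
    measurable; a bounded F is shifted by its bound to become nonnegative. *)
Lemma bmeas_E01 d (T : measurableType d) (F : T * R -> R) :
  bmeas F -> bmeas (fun x => E (fun y => F (x, y))).
Proof.
move=> bF; have bF2 x : bmeas (fun y => F (x, y)).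
  exact: (bmeas_comp (pair1_measurable x) bF).
have [mF [M FM]] := bF; split; last first.
  by exists M => x; apply: E01_norm.
(* The indicator restricts the inner integral over the line to the unit interval. *)
pose G (p : T * R) := ((F p + M) * \1_D p.2)%:E.
have G0 p : (0 <= G p)%E.
  rewrite lee_fin mulr_ge0 ?indicE ?ler0n//.
  by have := FM p; rewrite ler_norml => /andP[]; lra.
have mG : measurable_fun setT G.
  apply/measurable_EFinP; apply: measurable_funM; first exact: measurable_funD.
  apply: (@measurableT_comp _ _ _ _ _ _ (\1_D : R -> R)) => //.
  by apply: measurable_indic; exact: measurable_unit.
have mFM : measurable_fun setT (fun x => E (fun y => F (x, y)) + M).
  apply/measurable_EFinP.
  have := @measurable_fun_fubini_tonelli_F _ _ _ _ _ leb G mG G0.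
  congr (measurable_fun _ _); apply/funext => x /=; rewrite /fubini_F.
  rewrite -[X in _ + X](E01_cst M) -E01D//; last exact: bmeas_cst.
  rewrite EFin_E01; last by apply: bmeasD => //; exact: bmeas_cst.
  rewrite [RHS]integral_mkcond; apply: eq_integral => y _.
  by rewrite /G patchE indicE/=; case: ifP; rewrite ?mulr1 ?mulr0.
have -> : (fun x => E (fun y => F (x, y))) =
          (fun x => E (fun y => F (x, y)) + M - M).
  by apply/funext => x; rewrite addrK.
exact: measurable_funB.
Qed.

Lemma bmeas_swap (F : R * R -> R) : bmeas F -> bmeas (fun p => F (p.2, p.1)).
Proof.
by apply: (@bmeas_comp _ _ _ _ _ (fun p => (p.2, p.1))); apply: measurable_fun_pair.
Qed.

(** Both equalities are Fubini's theorem for F extended by 0 outside the unit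
    square, which is integrable on the plane. *)
Lemma Fubini_unit_square (F : R * R -> R) : bmeas F ->
  \int[(leb \x leb)%E]_(p in D `*` D) F p = E (fun x => E (fun y => F (x, y))) /\
  E (fun x => E (fun y => F (x, y))) = E (fun y => E (fun x => F (x, y))).
Proof.
move=> bF; have [mF [M FM]] := bF.
have mDD : measurable (D `*` D) by apply: measurableX; exact: measurable_unit.
have intF : (leb \x leb)%E.-integrable setT ((EFin \o F) \_ (D `*` D)).
  apply/integrable_restrict => //; rewrite setTI.
  apply: measurable_bounded_integrable => //.
  - rewrite [ltLHS](_ : _ = 1%E) ?ltry//.
    rewrite -[RHS]mule1 -[in RHS]leb_unit.
    by apply: (@product_measure1E _ _ _ _ _ leb leb); exact: measurable_unit.
  - exact: measurable_funTS.
  - by exists M; split; rewrite ?num_real // => x Mx y _ /=; rewrite (le_trans (FM y))// ltW.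
have EE : (\int[leb]_x \int[leb]_y ((EFin \o F) \_ (D `*` D)) (x, y) =
   (E (fun x => E (fun y => F (x, y))))%:E)%E.
  rewrite EFin_E01; last exact: bmeas_E01.
  rewrite [RHS]integral_mkcond; apply: eq_integral => x _.
  rewrite [RHS]patchE; case: ifPn => xD.
    rewrite EFin_E01; last exact: (bmeas_comp (pair1_measurable x) bF).
    rewrite [RHS]integral_mkcond; apply: eq_integral => y _.
    by rewrite !patchE in_setX xD.
  by apply: integral0_eq => y _; rewrite patchE in_setX (negbTE xD).
have EE' : (\int[leb]_y \int[leb]_x ((EFin \o F) \_ (D `*` D)) (x, y) =
   (E (fun y => E (fun x => F (x, y))))%:E)%E.
  rewrite EFin_E01; last exact: (bmeas_E01 (bmeas_swap bF)).
  rewrite [RHS]integral_mkcond; apply: eq_integral => y _.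
  rewrite [RHS]patchE; case: ifPn => yD.
    rewrite EFin_E01; last exact: (bmeas_comp (pair2_measurable y) bF).
    rewrite [RHS]integral_mkcond; apply: eq_integral => x _.
    by rewrite !patchE in_setX yD andbT.
  by apply: integral0_eq => x _; rewrite patchE in_setX (negbTE yD) andbF.
split; last by apply: EFin_inj; rewrite -EE -EE'; exact: Fubini.
rewrite /Rintegral integral_mkcond -integral12_prod_meas1//.
by rewrite /fubini_F EE.
Qed.

End E01_theory.

(** * Rectangles control all weights with values in the unit interval *)

Section cut_norm.
Variable R : realType.
Local Notation D := (unit_interval R).
Local Notation E := (E01 R).
Implicit Types (phi : R * R -> R) (u v : R -> R).

Lemma bmeas_weighted phi v : bmeas phi -> bmeas v ->
  bmeas (fun p : R * R => v p.2 * phi p).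
Proof. by move=> bphi bv; apply: bmeasM => //; exact: (bmeas_comp measurable_snd). Qed.

Lemma bmeas_E01_weighted phi v : bmeas phi -> bmeas v ->
  bmeas (fun x => E (fun y => v y * phi (x, y))).
Proof. by move=> bphi bv; exact: (bmeas_E01 (bmeas_weighted bphi bv)). Qed.

Lemma E01_weighted_swap phi u v : bmeas phi -> bmeas u -> bmeas v ->
  E (fun x => u x * E (fun y => v y * phi (x, y))) =
  E (fun y => v y * E (fun x => u x * phi (x, y))).
Proof.
move=> bphi bu bv.
have bF : bmeas (fun p : R * R => u p.1 * (v p.2 * phi p)).
  apply: bmeasM; last exact: bmeas_weighted.
  exact: (bmeas_comp measurable_fst).
have [_ swap] := Fubini_unit_square bF.
transitivity (E (fun x => E (fun y => u x * (v y * phi (x, y))))).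
  apply: eq_E01 => x _; rewrite E01Z//.
  exact: (bmeas_comp (pair1_measurable x) (bmeas_weighted bphi bv)).
rewrite swap; apply: eq_E01 => y _; rewrite -E01Z.
  by apply: eq_E01 => x _; ring.
by apply: bmeasM => //; exact: (bmeas_comp (pair2_measurable y) bphi).
Qed.

(** The integral of u I, for u between 0 and 1, is largest when u is the
    indicator of the set where I is nonnegative. *)
Lemma E01_weight_le_indic (I u : R -> R) : bmeas I -> bmeas u ->
    (forall x, 0 <= u x <= 1) ->
  exists S, [/\ measurable S, S `<=` D &
    E (fun x => u x * I x) <= E (fun x => \1_S x * I x)].
Proof.
move=> bI bu u01; exists (D `&` I @^-1` `[0, +oo[).
have mS : measurable (D `&` I @^-1` `[0, +oo[%classic).
  apply: (measurable_funTS bI.1); [exact: measurable_unit|exact: measurable_itv].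
split => //; apply: le_E01; [exact: bmeasM | |].
  by apply: bmeasM => //; exact: bmeas_indic.
move=> x Dx; rewrite indicE.
have /andP[u0 u1] := u01 x; have [I0|I0] := leP 0 (I x).
  by rewrite mem_set//= ?in_itv/= ?I0// ler_pM.
rewrite memNset ?mul0r; last by rewrite /= in_itv/= andbT leNgt I0 => -[].
by rewrite nmulr_lle0.
Qed.

(** The form is linear in each weight, so its supremum over weights between 0
    and 1 is attained at indicators: replace first u, then, after exchanging the
    integrals, v. *)
Lemma cut_norm_weights phi c : bmeas phi ->
    (forall S A, measurable S -> measurable A -> S `<=` D -> A `<=` D ->
       E (fun x => \1_S x * E (fun y => \1_A y * phi (x, y))) <= c) ->
  forall u v, bmeas u -> bmeas v ->
    (forall x, 0 <= u x <= 1) -> (forall x, 0 <= v x <= 1) ->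
  E (fun x => u x * E (fun y => v y * phi (x, y))) <= c.
Proof.
move=> bphi cut u v bu bv u01 v01.
have [S [mS SD uS]] := E01_weight_le_indic (bmeas_E01_weighted bphi bv) bu u01.
apply: le_trans uS _; have bS := bmeas_indic R mS.
rewrite E01_weighted_swap//.
have bJ : bmeas (fun y => E (fun x => \1_S x * phi (x, y))).
  exact: (bmeas_E01_weighted (bmeas_swap bphi) bS).
have [A [mA AD vA]] := E01_weight_le_indic bJ bv v01.
apply: le_trans vA _; rewrite -E01_weighted_swap//; first exact: cut.
exact: bmeas_indic.
Qed.

End cut_norm.

(** * Densities of graphons as iterated integrals *)

Section graphon_square.
Variable R : realType.
Local Notation D := (unit_interval R).
Local Notation E := (E01 R).
Implicit Types (f g : R * R -> R).

(** A graphon is measurable on the square only; extending it by 0 makes it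
    bounded and measurable on the whole plane. *)
Definition square_ext f : R * R -> R := f \_ (D `*` D).

Lemma square_extE f x y : D x -> D y -> square_ext f (x, y) = f (x, y).
Proof. by move=> Dx Dy; rewrite /square_ext patchE in_setX !mem_set. Qed.

Lemma square_ext01 f p : graphon R f -> 0 <= square_ext f p <= 1.
Proof.
move=> [_ f01 _]; rewrite /square_ext patchE; case: ifPn; last by rewrite lexx ler01.
by case: p => x y; rewrite in_setX => /andP[/set_mem Dx /set_mem Dy]; exact: f01.
Qed.

Lemma bmeas_square_ext f : graphon R f -> bmeas (square_ext f).
Proof.
move=> gf; split; last first.
  by exists 1 => p; have /andP[f0 f1] := square_ext01 p gf; rewrite ger0_norm.
have [mf _ _] := gf; apply/(measurable_restrictT _ _).1 => //.
by apply: measurableX; exact: measurable_unit.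
Qed.

Lemma t_edgeE f : graphon R f ->
  t_edge f = E (fun x => E (fun y => square_ext f (x, y))).
Proof.
move=> gf; have [<- _] := Fubini_unit_square (bmeas_square_ext gf).
apply: eq_Rintegral => -[x y]; rewrite in_setX => /andP[/set_mem Dx /set_mem Dy].
by rewrite square_extE.
Qed.

End graphon_square.

(** * The cut distance and the edge density *)

Section counting.
Variable R : realType.
Local Notation leb := (@lebesgue_measure R).
Local Notation D := (unit_interval R).
Local Notation E := (E01 R).
Implicit Types (f g : R * R -> R).

Lemma Rintegral_rect f g (S A : set R) : graphon R f -> graphon R g ->
    measurable S -> measurable A -> S `<=` D -> A `<=` D ->
  \int[(leb \x leb)%E]_(p in S `*` A) (f p - g p) =
  E (fun x => \1_S x *
    E (fun y => \1_A y * (square_ext f (x, y) - square_ext g (x, y)))).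
Proof.
move=> gf gg mS mA SD AD.
have bfg := bmeasB (bmeas_square_ext gf) (bmeas_square_ext gg).
have bS := bmeas_indic R mS; have bA := bmeas_indic R mA.
pose F (p : R * R) : R :=
  \1_S p.1 * (\1_A p.2 * (square_ext f p - square_ext g p)).
have bF : bmeas F.
  apply: bmeasM; first exact: (bmeas_comp measurable_fst).
  exact: (bmeas_weighted bfg bA).
have [eF _] := Fubini_unit_square bF.
transitivity (\int[(leb \x leb)%E]_(p in D `*` D) F p).
  rewrite Rintegral_mkcond [RHS]Rintegral_mkcond; apply: eq_Rintegral => -[x y] _.
  rewrite !patchE !in_setX /F !indicE/=.
  case: (boolP (x \in S)) => [/set_mem Sx|xS]; last by rewrite mul0r if_same.
  case: (boolP (y \in A)) => [/set_mem Ay|yA]; last first.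
    by rewrite mul0r mulr0 if_same.
  rewrite !mem_set/=; [|exact: AD|exact: SD].
  by rewrite !mul1r !square_extE//; [exact: SD|exact: AD|exact: SD|exact: AD].
rewrite eF; apply: eq_E01 => x _; rewrite -E01Z//.
exact: (bmeas_comp (pair1_measurable x) (bmeas_weighted bfg bA)).
Qed.

(** The rectangle integrals are bounded by 1, so the supremum defining the cut
    distance bounds each of them. *)
Lemma cut_dist_ub f g (S A : set R) : graphon R f -> graphon R g ->
    measurable S -> measurable A -> S `<=` D -> A `<=` D ->
  `|E (fun x => \1_S x *
    E (fun y => \1_A y * (square_ext f (x, y) - square_ext g (x, y))))| <=
  cut_dist f g.
Proof.
move=> gf gg mS mA SD AD.
have bfg := bmeasB (bmeas_square_ext gf) (bmeas_square_ext gg).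
apply: ub_le_sup; last first.
  by exists S, A; split => //; rewrite Rintegral_rect.
exists 1 => _ [S' [A' [mS' mA' SD' AD' ->]]]; rewrite Rintegral_rect//.
have ind (B : set R) x : `|\1_B x| <= 1 :> R.
  by rewrite indicE; case: (_ \in _); rewrite ?normr1// normr0.
have bA := bmeas_indic R mA'.
apply: E01_norm => [|x _].
  by apply: bmeasM; [exact: bmeas_indic|exact: (bmeas_E01_weighted bfg bA)].
rewrite normrM -[leRHS]mulr1 ler_pM//; apply: E01_norm => [|y _].
  exact: (bmeas_comp (pair1_measurable x) (bmeas_weighted bfg bA)).
rewrite normrM -[leRHS]mulr1 ler_pM//.
have /andP[f0 f1] := square_ext01 (x, y) gf.
have /andP[g0 g1] := square_ext01 (x, y) gg.
by rewrite ler_norml; lra.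
Qed.

(** The bound holds without the absolute value for f - g and for g - f. *)
Lemma cut_dist_weights f g : graphon R f -> graphon R g ->
  forall u v, bmeas u -> bmeas v ->
    (forall x, 0 <= u x <= 1) -> (forall x, 0 <= v x <= 1) ->
  `|E (fun x => u x *
    E (fun y => v y * (square_ext f (x, y) - square_ext g (x, y))))|
    <= cut_dist f g.
Proof.
move=> gf gg u v bu bv u01 v01.
have bfg := bmeasB (bmeas_square_ext gf) (bmeas_square_ext gg).
have bgf := bmeasB (bmeas_square_ext gg) (bmeas_square_ext gf).
have opp (u' v' : R -> R) : bmeas u' -> bmeas v' ->
    - E (fun x => u' x *
      E (fun y => v' y * (square_ext f (x, y) - square_ext g (x, y)))) =
    E (fun x => u' x *
      E (fun y => v' y * (square_ext g (x, y) - square_ext f (x, y)))).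
  move=> bu' bv'; rewrite -mulN1r -E01Z; last first.
    by apply: bmeasM => //; exact: (bmeas_E01_weighted bfg bv').
  apply: eq_E01 => x _; rewrite mulrCA; congr (_ * _).
  rewrite -E01Z; last first.
    exact: (bmeas_comp (pair1_measurable x) (bmeas_weighted bfg bv')).
  by apply: eq_E01 => y _; ring.
rewrite ler_norml lerNl opp//; apply/andP; split.
  apply: (@cut_norm_weights _ (fun p => square_ext g p - square_ext f p)) => //.
  move=> S A mS mA SD AD; rewrite -opp; [|exact: bmeas_indic..].
  by rewrite (le_trans _ (cut_dist_ub gf gg mS mA SD AD))// -normrN ler_norm.
apply: (@cut_norm_weights _ (fun p => square_ext f p - square_ext g p)) => //.
by move=> S A mS mA SD AD; rewrite (le_trans (ler_norm _))// cut_dist_ub.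
Qed.

Lemma t_edge_cut_dist f g : graphon R f -> graphon R g ->
  `|t_edge f - t_edge g| <= cut_dist f g.
Proof.
move=> gf gg; rewrite !t_edgeE//.
have bf := bmeas_square_ext gf; have bg := bmeas_square_ext gg.
rewrite -E01B; [|exact: bmeas_E01..].
have one01 (x : R) : 0 <= (1 : R) <= 1 by rewrite ler01 lexx.
have := cut_dist_weights gf gg (@bmeas_cst _ R _ 1) (@bmeas_cst _ R _ 1) one01 one01.
congr (`|_| <= _); apply: eq_E01 => x _; rewrite mul1r -E01B; last 2 first.
- exact: (bmeas_comp (pair1_measurable x) bf).
- exact: (bmeas_comp (pair1_measurable x) bg).
by apply: eq_E01 => y _; rewrite mul1r.
Qed.

End counting.

(** * The triangle counting lemma *)

Ltac measurable_coordinates :=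
  repeat apply: measurable_fun_pair;
  repeat first [exact: measurable_fst | exact: measurable_snd
               | exact: measurable_id | exact: measurable_cst
               | apply: (measurableT_comp measurable_fst)
               | apply: (measurableT_comp measurable_snd)].

Definition E01_3 (R : realType) (H : R * R * R -> R) : R :=
  E01 R (fun x => E01 R (fun y => E01 R (fun z => H (x, y, z)))).

(** The triangle integrand with three different edge functions, as needed to
    replace one edge at a time. *)
Definition cyclic_prod (R : realType) (A B C : R * R -> R) (q : R * R * R) : R :=
  A (q.1.1, q.1.2) * B (q.1.2, q.2) * C (q.2, q.1.1).

Section triangles.
Variable R : realType.
Local Notation E := (E01 R).
Implicit Types (f g : R * R -> R) (H : R * R * R -> R).

Lemma bmeas_section2 H x : bmeas H -> bmeas (fun p : R * R => H (x, p.1, p.2)).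
Proof.
move=> bH; apply: (@bmeas_comp _ _ _ _ _ (fun p : R * R => (x, p.1, p.2)) H) => //.
by measurable_coordinates.
Qed.

Lemma bmeas_E01_2 H : bmeas H -> bmeas (fun x => E (fun y => E (fun z => H (x, y, z)))).
Proof. by move=> bH; exact: (bmeas_E01 (bmeas_E01 bH)). Qed.

Lemma E01_3_rot H : bmeas H -> E01_3 H = E01_3 (fun q => H (q.1.2, q.2, q.1.1)).
Proof.
move=> bH.
transitivity (E (fun x => E (fun z => E (fun y => H (x, y, z))))).
  apply: eq_E01 => x _.
  by have [_ ->] := Fubini_unit_square (bmeas_section2 x bH).
have bK : bmeas (fun p : R * R => E (fun y => H (p.1, y, p.2))).
  apply: (@bmeas_E01 _ _ _ (fun q : R * R * R => H (q.1.1, q.2, q.1.2))).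
  apply: (@bmeas_comp _ _ _ _ _ (fun q : R * R * R => (q.1.1, q.2, q.1.2)) H) => //.
  by measurable_coordinates.
by have [_ ->] := Fubini_unit_square bK.
Qed.

Lemma bmeas_cyclic_prod (A B C : R * R -> R) : bmeas A -> bmeas B -> bmeas C ->
  bmeas (cyclic_prod A B C).
Proof.
move=> bA bB bC; repeat apply: bmeasM.
- apply: (@bmeas_comp _ _ _ _ _ (fun q : R * R * R => (q.1.1, q.1.2)) A) => //.
  by measurable_coordinates.
- apply: (@bmeas_comp _ _ _ _ _ (fun q : R * R * R => (q.1.2, q.2)) B) => //.
  by measurable_coordinates.
- apply: (@bmeas_comp _ _ _ _ _ (fun q : R * R * R => (q.2, q.1.1)) C) => //.
  by measurable_coordinates.
Qed.

Lemma E01_3_cyclic_rot (A B C : R * R -> R) : bmeas A -> bmeas B -> bmeas C ->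
  E01_3 (cyclic_prod A B C) = E01_3 (cyclic_prod B C A).
Proof.
move=> bA bB bC; rewrite [RHS]E01_3_rot; last exact: bmeas_cyclic_prod.
by congr E01_3; apply/funext => q; rewrite /cyclic_prod/=; ring.
Qed.

(** For fixed x, A (x, y) and B (z, x) are weights in y and z, so the inner
    double integral is bounded by the cut distance. *)
Lemma E01_3_cyclic_cut f g (A B : R * R -> R) : graphon R f -> graphon R g ->
    bmeas A -> bmeas B -> (forall p, 0 <= A p <= 1) -> (forall p, 0 <= B p <= 1) ->
  `|E01_3 (cyclic_prod A (fun p => square_ext f p - square_ext g p) B)|
    <= cut_dist f g.
Proof.
move=> gf gg bA bB A01 B01.
have bfg := bmeasB (bmeas_square_ext gf) (bmeas_square_ext gg).
apply: E01_norm => [|x _].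
  exact: (bmeas_E01_2 (bmeas_cyclic_prod bA bfg bB)).
have bAx : bmeas (fun y => A (x, y)) := bmeas_comp (pair1_measurable x) bA.
have bBx : bmeas (fun z => B (z, x)) := bmeas_comp (pair2_measurable x) bB.
have := cut_dist_weights gf gg bAx bBx (fun y => A01 (x, y)) (fun z => B01 (z, x)).
congr (`|_| <= _); apply: eq_E01 => y _.
rewrite -E01Z; first by apply: eq_E01 => z _; rewrite /cyclic_prod/=; ring.
exact: (bmeas_comp (pair1_measurable y) (bmeas_weighted bfg bBx)).
Qed.

Lemma E01_3D H K : bmeas H -> bmeas K ->
  E01_3 (fun q => H q + K q) = E01_3 H + E01_3 K.
Proof.
move=> bH bK; rewrite /E01_3 -E01D; [|exact: bmeas_E01_2..].
apply: eq_E01 => x _; rewrite -E01D; last 2 first.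
- exact: (bmeas_E01 (bmeas_section2 x bH)).
- exact: (bmeas_E01 (bmeas_section2 x bK)).
apply: eq_E01 => y _; rewrite -E01D//.
- exact: (bmeas_comp (pair1_measurable (x, y)) bH).
- exact: (bmeas_comp (pair1_measurable (x, y)) bK).
Qed.

Lemma t_triangleE f : t_triangle f =
  E01_3 (cyclic_prod (square_ext f) (square_ext f) (square_ext f)).
Proof.
apply: eq_E01 => x Dx; apply: eq_E01 => y Dy; apply: eq_E01 => z Dz.
by rewrite /cyclic_prod/= !square_extE.
Qed.

(** Counting lemma: replace g by f in the three edges one after the other.  In
    each of the three differences a cyclic rotation of the variables brings the
    factor f - g to the middle. *)
Lemma t_triangle_cut_dist f g : graphon R f -> graphon R g ->
  `|t_triangle f - t_triangle g| <= 3 * cut_dist f g.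
Proof.
have norm3 (a b c e : R) :
    `|a| <= e -> `|b| <= e -> `|c| <= e -> `|a + (b + c)| <= 3 * e.
  by rewrite !ler_norml => /andP[? ?] /andP[? ?] /andP[? ?]; lra.
move=> gf gg; rewrite !t_triangleE.
have bf := bmeas_square_ext gf; have bg := bmeas_square_ext gg.
pose d p := square_ext f p - square_ext g p.
have bd : bmeas d := bmeasB bf bg.
have f01 p := square_ext01 p gf; have g01 p := square_ext01 p gg.
have h1 := E01_3_cyclic_cut gf gg bf bf f01 f01.
have h2 := E01_3_cyclic_cut gf gg bg bf g01 f01.
have h3 := E01_3_cyclic_cut gf gg bg bg g01 g01.
rewrite -/d in h1 h2 h3.
have Fd p : square_ext f p = square_ext g p + d p by rewrite /d addrC subrK.
move: h1 h2 h3 Fd bf bg bd; clearbody d.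
move: (square_ext f) (square_ext g) => F G h1 h2 h3 Fd bF bG bd.
have b1 := bmeas_cyclic_prod bd bF bF.
have b2 := bmeas_cyclic_prod bG bd bF.
have b3 := bmeas_cyclic_prod bG bG bd.
have b23 := bmeasD b2 b3; have b123 := bmeasD b1 b23.
have -> : cyclic_prod F F F = fun q => cyclic_prod G G G q +
    (cyclic_prod d F F q + (cyclic_prod G d F q + cyclic_prod G G d q)).
  by apply/funext => q; rewrite /cyclic_prod !Fd; ring.
rewrite (E01_3D (bmeas_cyclic_prod bG bG bG) b123) (E01_3D b1 b23) (E01_3D b2 b3).
have addKB (a b : R) : a + b - a = b by rewrite addrAC subrr add0r.
rewrite {}addKB.
(* Rotate the first and the last difference. *)
have -> : E01_3 (cyclic_prod d F F) = E01_3 (cyclic_prod F d F).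
  by rewrite (E01_3_cyclic_rot bd bF bF) (E01_3_cyclic_rot bF bF bd).
have -> : E01_3 (cyclic_prod G G d) = E01_3 (cyclic_prod G d G).
  by rewrite (E01_3_cyclic_rot bG bG bd).
exact: (norm3 _ _ _ _ h1 h2 h3).
Qed.

End triangles.

(** * Measure-preserving changes of variable *)

Section measure_preserving.
Variable R : realType.
Local Notation leb := (@lebesgue_measure R).
Local Notation D := (unit_interval R).
Local Notation E := (E01 R).
Implicit Types (f g : R * R -> R) (sigma : R -> R).

Lemma mp_bijection_unit sigma x : mp_bijection R sigma -> D x -> D (sigma x).
Proof. by move=> [[sD _ _] _ _]; exact: sD. Qed.

(** Extending sigma by the identity gives a map that is measurable on the whole
    line and preserves both the unit interval and its complement. *)
Definition unit_patch sigma x : R := if x \in D then sigma x else x.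

Lemma measurable_unit_patch sigma : mp_bijection R sigma ->
  measurable_fun setT (unit_patch sigma).
Proof.
move=> [_ ms _]; apply: measurable_fun_if => //.
- apply: (measurable_fun_bool true).
  rewrite setTI (_ : _ @^-1` _ = D); first exact: measurable_unit.
  by apply/seteqP; split => x /=; [move/set_mem|move/mem_set].
- rewrite setTI (_ : _ @^-1` _ = D) //.
  by apply/seteqP; split => x /=; [move/set_mem|move/mem_set].
Qed.

(** sigma pushes the Lebesgue measure of the unit interval forward to itself. *)
Lemma E01_mp sigma (h : R -> R) : mp_bijection R sigma -> bmeas h ->
  E (fun x => h (sigma x)) = E h.
Proof.
move=> ms bh; have mt := measurable_unit_patch ms.
have preD : unit_patch sigma @^-1` D = D.
  apply/seteqP; split => x /=; rewrite /unit_patch.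
    by case: ifPn => [/set_mem//|].
  by move=> Dx; rewrite mem_set//; exact: mp_bijection_unit.
have [_ mh] := bh.
transitivity (E (fun x => h (unit_patch sigma x))).
  by apply: eq_E01 => x Dx; rewrite /unit_patch mem_set.
apply: EFin_inj; rewrite !EFin_E01//; last exact: (bmeas_comp mt bh).
have intf : leb.-integrable (unit_patch sigma @^-1` D)
    ((EFin \o h) \o unit_patch sigma).
  rewrite preD; exact: (bmeas_integrable (bmeas_comp mt bh)).
have mhE : measurable_fun setT (EFin \o h) by apply/measurable_EFinP; case: bh.
have := @integral_pushforward _ _ (measurableTypeR R) (measurableTypeR R) R
  (unit_patch sigma) mt leb D (EFin \o h) mhE intf (@measurable_unit R).
rewrite preD => <-; apply: eq_measure_integral => A mA AD.
rewrite /pushforward/=; have [_ _ <-//] := ms; congr (leb _).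
apply/seteqP; split => x /=; rewrite /unit_patch.
  case: ifPn => [/set_mem Dx //|xD] /AD.
  by move: xD => /negP xD /mem_set.
by move=> [Dx As]; rewrite mem_set.
Qed.

End measure_preserving.

(** * Densities of graphons close to the constants *)

Section classes.
Variable R : realType.
Local Notation D := (unit_interval R).
Implicit Types (f g : R * R -> R) (sigma : R -> R).

Lemma graphon_relabel f sigma : graphon R f -> mp_bijection R sigma ->
  graphon R (relabel f sigma).
Proof.
move=> gf ms; have [_ f01 fC] := gf; split.
- have mDD : measurable (D `*` D) by apply: measurableX; exact: measurable_unit.
  have mt := measurable_unit_patch ms.
  apply: (eq_measurable_fun
    (fun p => square_ext f (unit_patch sigma p.1, unit_patch sigma p.2))).
    move=> [x y]; rewrite in_setX => /andP[xD yD].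
    rewrite /unit_patch/= xD yD square_extE//; apply: mp_bijection_unit => //;
      exact/set_mem.
  apply: measurable_funTS.
  apply: (bmeas_comp (h := fun p : R * R => (unit_patch sigma p.1, unit_patch sigma p.2))
    _ (bmeas_square_ext gf)).1.
  by apply: measurable_fun_pair; apply: (measurableT_comp mt).
- by move=> x y Dx Dy; apply: f01; exact: mp_bijection_unit.
- by move=> x y Dx Dy; apply: fC; exact: mp_bijection_unit.
Qed.

Lemma square_ext_relabel f sigma x y : mp_bijection R sigma -> D x -> D y ->
  square_ext (relabel f sigma) (x, y) = square_ext f (sigma x, sigma y).
Proof.
by move=> ms Dx Dy; rewrite !square_extE//; exact: mp_bijection_unit.
Qed.

Lemma t_edge01 f : graphon R f -> 0 <= t_edge f <= 1.
Proof.
move=> gf; rewrite t_edgeE//; have bf := bmeas_square_ext gf.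
apply/andP; split.
  apply: E01_ge => [|x _]; first exact: bmeas_E01.
  apply: E01_ge => [|y _]; first exact: (bmeas_comp (pair1_measurable x) bf).
  by case/andP: (square_ext01 (x, y) gf).
apply: E01_le => [|x _]; first exact: bmeas_E01.
apply: E01_le => [|y _]; first exact: (bmeas_comp (pair1_measurable x) bf).
by case/andP: (square_ext01 (x, y) gf).
Qed.

Lemma t_edge_relabel f sigma : graphon R f -> mp_bijection R sigma ->
  t_edge (relabel f sigma) = t_edge f.
Proof.
move=> gf ms; have bf := bmeas_square_ext gf.
rewrite (t_edgeE gf) (t_edgeE (graphon_relabel gf ms)).
rewrite -[RHS](E01_mp ms); last exact: bmeas_E01.
apply: eq_E01 => x Dx.
rewrite -[RHS](E01_mp ms); last exact: (bmeas_comp (pair1_measurable (sigma x)) bf).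
by apply: eq_E01 => y Dy; rewrite square_ext_relabel.
Qed.

Lemma t_triangle_relabel f sigma : graphon R f -> mp_bijection R sigma ->
  t_triangle (relabel f sigma) = t_triangle f.
Proof.
move=> gf ms; have bf := bmeas_square_ext gf.
have bH := bmeas_cyclic_prod bf bf bf.
rewrite !t_triangleE /E01_3 -[RHS](E01_mp ms); last exact: (bmeas_E01_2 bH).
apply: eq_E01 => x Dx.
rewrite -[RHS](E01_mp ms); last first.
  exact: (bmeas_E01 (bmeas_section2 (sigma x) bH)).
apply: eq_E01 => y Dy; rewrite -[RHS](E01_mp ms); last first.
  exact: (bmeas_comp (pair1_measurable (sigma x, sigma y)) bH).
by apply: eq_E01 => z Dz; rewrite /cyclic_prod/= !square_ext_relabel.
Qed.

Lemma graphon_cst c : D c -> graphon R (fun=> c).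
Proof. by rewrite /unit_interval/= in_itv/=; split. Qed.

Lemma t_edge_cst c : D c -> t_edge (fun=> c) = c.
Proof.
move=> Dc; rewrite t_edgeE; last exact: graphon_cst.
rewrite -[RHS]E01_cst; apply: eq_E01 => x Dx; rewrite -[RHS]E01_cst.
by apply: eq_E01 => y Dy; rewrite square_extE.
Qed.

Lemma t_triangle_cst c : t_triangle (fun _ : R * R => c) = c ^+ 3.
Proof.
rewrite /t_triangle.
rewrite -[RHS]E01_cst; apply: eq_E01 => x Dx; rewrite -[RHS]E01_cst.
apply: eq_E01 => y Dy; rewrite -[RHS]E01_cst; apply: eq_E01 => z Dz.
by rewrite !exprS expr0 mulr1 mulrA.
Qed.

Lemma mp_bijection_id : mp_bijection R id.
Proof.
split => //; first by split => // x Dx; exists x.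
by move=> A mA AD; rewrite preimage_id setIidr.
Qed.

Lemma cut_dist_refl f : cut_dist f f = 0.
Proof.
rewrite /cut_dist (_ : [set _ | _] = [set 0]) ?sup1//; apply/seteqP; split.
  move=> r [S [A [_ _ _ _ ->]]] /=.
  under eq_Rintegral do rewrite subrr.
  by rewrite /Rintegral integral0 /= normr0.
move=> _ ->; exists set0, set0; split => //.
by rewrite /Rintegral set0X integral_set0 normr0.
Qed.

Lemma tilde_refl f : graphon R f -> tilde f f.
Proof.
move=> gf; split => // e e0; exists id; first exact: mp_bijection_id.
rewrite (_ : relabel f id = f) ?cut_dist_refl//.
by apply/funext => -[].
Qed.

(** The factor 3 is the Lipschitz constant of the triangle density; with it,
    the relation composes by adding the errors. *)
Definition densities_within (e : R) f g :=
  `|t_edge f - t_edge g| < e /\ `|t_triangle f - t_triangle g| < 3 * e.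

Lemma densities_within_relabel f g sigma e : graphon R f -> graphon R g ->
  mp_bijection R sigma -> cut_dist f (relabel g sigma) < e ->
  densities_within e f g.
Proof.
move=> gf gg ms lte; have gr := graphon_relabel gg ms; split.
  by rewrite -(t_edge_relabel gg ms) (le_lt_trans (t_edge_cut_dist gf gr)).
rewrite -(t_triangle_relabel gg ms) (le_lt_trans (t_triangle_cut_dist gf gr))//.
by rewrite ltr_pM2l.
Qed.

Lemma densities_within_trans f g h d e : densities_within d f g ->
  densities_within e g h -> densities_within (d + e) f h.
Proof.
move=> [fg1 fg3] [gh1 gh3]; split.
  by rewrite (le_lt_trans (ler_distD (t_edge g) _ _))// ltrD.
by rewrite (le_lt_trans (ler_distD (t_triangle g) _ _))// mulrDr ltrD.
Qed.

Lemma densities_within_sym f g d : densities_within d f g -> densities_within d g f.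
Proof. by move=> [fg1 fg3]; split; rewrite distrC. Qed.

Lemma tilde_densities f g e : graphon R g -> tilde g f -> 0 < e -> densities_within e f g.
Proof.
move=> gg [gf close] e0; have [sigma ms lte] := close e e0.
exact: densities_within_relabel lte.
Qed.

(** Both infima in the distance between classes are approached by some
    representatives f1, g1 and some relabeling, and f, g lie in the classes of f1, g1;
    densities then move by a small amount along f, f1, g1, g. *)
Lemma delta_cut_densities f g e : graphon R f -> graphon R g -> 0 < e ->
  delta_cut (tilde f) (tilde g) < e -> densities_within (e + e) f g.
Proof.
move=> gf gg e0 /inf_lt[|_ [f1 [g1 [gf1 gg1 tf tg ->]]]].
  by exists (delta_cut_fun f g), f, g.
move=> /inf_lt[|_ [sigma ms <-] lte].
  by exists (cut_dist f1 (relabel g1 id)); exists id; first exact: mp_bijection_id.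
have e20 : 0 < e / 2 by rewrite divr_gt0.
have -> : e + e = e / 2 + (e + e / 2) by lra.
have tf1 : tilde f1 f by rewrite tf; exact: tilde_refl.
have tg1 : tilde g1 g by rewrite tg; exact: tilde_refl.
apply: densities_within_trans (tilde_densities gf1 tf1 e20) _.
apply: densities_within_trans (densities_within_relabel gf1 gg1 ms lte) _.
exact: densities_within_sym (tilde_densities gg1 tg1 e20).
Qed.

Lemma near_constant_densities f e : graphon R f -> 0 < e ->
    delta_cut_set (tilde f) (constant_classes R) < e ->
  exists2 c, D c & densities_within (e + e) f (fun=> c).
Proof.
move=> gf e0 /inf_lt[|_ [_ [c Dc <-] <-] lte].
  exists (delta_cut (tilde f) (tilde (fun=> 0))); exists (tilde (fun=> 0)) => //.
  by exists 0 => //; rewrite /unit_interval/= in_itv/= lexx ler01.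
by exists c => //; apply: delta_cut_densities lte => //; exact: graphon_cst.
Qed.

(** For a constant c at distance less than e, both densities are controlled up to
    2 e and 6 e, and cubing is 3-Lipschitz on the unit interval. *)
Lemma near_constant_triangle_lb f e : graphon R f -> 0 < e ->
    delta_cut_set (tilde f) (constant_classes R) < e ->
  t_edge f ^+ 3 - 12 * e <= t_triangle f.
Proof.
move=> gf e0 /(near_constant_densities gf e0)[c Dc].
rewrite /densities_within t_edge_cst// t_triangle_cst => -[ec tc].
have /andP[e0' e1] := t_edge01 gf.
move: Dc; rewrite /unit_interval/= in_itv/= => /andP[c0 c1].
move: ec tc e0' e1; move: (t_edge f) (t_triangle f) => a t ec tc a0 a1.
move: ec tc; rewrite !ltr_norml => /andP[_ ac] /andP[ct _].
have cube : a ^+ 3 - c ^+ 3 <= 6 * e.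
  rewrite subrXX !big_ord_recr big_ord0/= add0r !subnE/=.
  have [ca|ac'] := leP c a.
    have : 0 <= a ^+ 2 + a * c + c ^+ 2 <= 3 by rewrite !expr2; nra.
    nra.
  have : 0 <= a ^+ 2 + a * c + c ^+ 2 by rewrite !expr2; nra.
  nra.
lra.
Qed.

End classes.

(** * The graphon of a finite graph *)

Section finite_sums.
Variable R : realType.
Local Notation E := (E01 R).

Lemma bmeas_sum d (T : measurableType d) (I : Type) (r : seq I) (F : I -> T -> R) :
  (forall i, bmeas (F i)) -> bmeas (fun x => \sum_(i <- r) F i x).
Proof.
move=> bF; elim: r => [|i r IH].
  by under eq_fun do rewrite big_nil; exact: bmeas_cst.
by under eq_fun do rewrite big_cons; exact: bmeasD.
Qed.

Lemma E01_sum (I : Type) (r : seq I) (F : I -> R -> R) : (forall i, bmeas (F i)) ->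
  E (fun x => \sum_(i <- r) F i x) = \sum_(i <- r) E (F i).
Proof.
move=> bF; elim: r => [|i r IH].
  by under eq_fun do rewrite big_nil; rewrite E01_cst big_nil.
under eq_fun do rewrite big_cons; rewrite E01D//; last exact: bmeas_sum.
by rewrite IH big_cons.
Qed.

Lemma E01_indic (A : set R) : measurable A -> A `<=` unit_interval R ->
  E (\1_A) = fine (lebesgue_measure A).
Proof.
move=> mA AD; rewrite /E01 /Rintegral integral_indic//; last exact: measurable_unit.
by rewrite setIidl.
Qed.

End finite_sums.

Lemma natr_exists_unique (R : pzSemiRingType) (I : finType) (P a : pred I) :
    (forall i j, P i -> P j -> i = j) ->
  [exists i, P i && a i]%:R = \sum_i (P i)%:R * (a i)%:R :> R.
Proof.
move=> uP; have [i Pi|nP] := pickP P.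
  rewrite (bigD1 i)//= Pi mul1r big1 ?addr0 => [|j ji]; last first.
    case: (boolP (P j)) => [/uP/(_ Pi) ij|]; last by rewrite mul0r.
    by rewrite ij eqxx in ji.
  congr (_%:R); congr nat_of_bool; apply/existsP/idP => [[j /andP[/uP/(_ Pi)->//]]|ai].
  by exists i; rewrite Pi ai.
rewrite big1 => [|j _]; last by rewrite nP mul0r.
by case: existsP => // -[j]; rewrite nP.
Qed.

Lemma eq_set2 (T : finType) (i j x y : T) : x != y ->
  ([set i; j]%SET == [set x; y]%SET) = ((i, j) \in [set (x, y); (y, x)]%SET).
Proof.
move=> xy; rewrite in_set2 !xpair_eqE; apply/idP/orP => [/eqP eqS|]; last first.
  by case=> /andP[/eqP-> /eqP->]; rewrite ?eqxx// finset.setUC eqxx.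
have mem z : (z == i) || (z == j) = (z == x) || (z == y) by rewrite -!in_set2 eqS.
have := mem x; have := mem y; have := mem j; have := mem i.
rewrite !eqxx ?orbT/= => /esym/orP[]/eqP-> /esym/orP[]/eqP->;
  rewrite ?eqxx ?[y == x]eq_sym ?(negbTE xy)//=; by [left|right].
Qed.

Section graph_graphon.
Variables (R : realType) (n : nat).
Hypothesis n_gt0 : (0 < n)%N.
Implicit Types (G : simple_graph n) (i j : 'I_n).
Local Notation D := (unit_interval R).
Local Notation E := (E01 R).

Definition adj G i j := [set i; j]%SET \in edges G.

(** The preimage of the vertex i + 1 under the ceiling of n x. *)
Definition cell i : set R := `](i%:R / n%:R), (i.+1%:R / n%:R)]%classic.

Lemma ceil_cell i (x : R) : (Num.ceil (n%:R * x) == Posz i.+1) = (x \in cell i).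
Proof.
have n0 : 0 < n%:R :> R by rewrite ltr0n.
rewrite ceil_eq /cell mem_setE in_itv/= ltr_pdivrMr// ler_pdivlMr// [x * _]mulrC.
by rewrite -addn1 PoszD addrK.
Qed.

Lemma measurable_cell i : measurable (cell i).
Proof. exact: measurable_itv. Qed.

Lemma cell_unit i : cell i `<=` D.
Proof.
have n0 : 0 < n%:R :> R by rewrite ltr0n.
move=> x; rewrite /cell /unit_interval/= !in_itv/= => /andP[ix xi].
apply/andP; split; first by apply: le_trans (ltW ix); rewrite divr_ge0.
by rewrite (le_trans xi)// ler_pdivrMr// mul1r ler_nat.
Qed.

Lemma E01_cell i : E (\1_(cell i)) = n%:R^-1.
Proof.
have n0 : 0 < n%:R :> R by rewrite ltr0n.
rewrite E01_indic; [|exact: measurable_cell|exact: cell_unit].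
rewrite /cell lebesgue_measure_itv/= lte_fin ltr_pM2r ?invr_gt0// ltr_nat leqnn.
by rewrite -EFinD/= -mulrBl -natrB// subSnn mul1r.
Qed.

Lemma graph_funE G p : graph_fun R G p =
  \sum_i \1_(cell i) p.1 * \sum_j \1_(cell j) p.2 * (adj G i j)%:R.
Proof.
have uceil (x : R) (i j : 'I_n) : Num.ceil (n%:R * x) == Posz i.+1 ->
    Num.ceil (n%:R * x) == Posz j.+1 -> i = j.
  by move=> /eqP-> /eqP[] /val_inj.
transitivity ([exists i, (p.1 \in cell i) &&
    [exists j, (p.2 \in cell j) && adj G i j]]%:R : R).
  rewrite /graph_fun; congr (_%:R); congr nat_of_bool.
  apply: eq_existsb => i; apply/existsP/andP => [[j]|[pi /existsP[j]]].
    rewrite !ceil_cell => /and3P[-> ? ?]; split => //.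
    by apply/existsP; exists j; apply/andP.
  by exists j; rewrite !ceil_cell pi.
rewrite natr_exists_unique; last first.
  by move=> i j; rewrite -!ceil_cell; exact: uceil.
apply: eq_bigr => i _; rewrite indicE natr_exists_unique; last first.
  by move=> j k; rewrite -!ceil_cell; exact: uceil.
by congr (_ * _); apply: eq_bigr => j _; rewrite indicE.
Qed.

Lemma bmeas_graph_fun G : bmeas (graph_fun R G).
Proof.
rewrite (_ : graph_fun R G = fun p =>
  \sum_i \1_(cell i) p.1 * \sum_j \1_(cell j) p.2 * (adj G i j)%:R); last first.
  by apply/funext => p; exact: graph_funE.
apply: bmeas_sum => i; apply: bmeasM.
  exact: (bmeas_comp measurable_fst (bmeas_indic R (measurable_cell i))).
apply: bmeas_sum => j; apply: bmeasM; last exact: bmeas_cst.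
exact: (bmeas_comp measurable_snd (bmeas_indic R (measurable_cell j))).
Qed.

Lemma graph_fun01 G p : 0 <= graph_fun R G p <= 1.
Proof. by rewrite /graph_fun ler0n lern1; case: existsP. Qed.

Lemma graph_funC G x y : graph_fun R G (x, y) = graph_fun R G (y, x).
Proof.
rewrite /graph_fun/=; congr (_%:R); congr nat_of_bool.
by apply/existsP/existsP => -[i /existsP[j /and3P[a b c]]];
  exists j; apply/existsP; exists i; rewrite a b finset.setUC c.
Qed.

Lemma graphon_graph_fun G : graphon R (graph_fun R G).
Proof.
split; first by apply: measurable_funTS; case: (bmeas_graph_fun G).
- by move=> x y _ _; exact: graph_fun01.
- by move=> x y _ _; exact: graph_funC.
Qed.

(** Each edge is the image of exactly two ordered pairs of vertices. *)
Lemma card_adj G : (\sum_i \sum_j (adj G i j : nat) = 2 * #|edges G|)%N.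
Proof.
rewrite pair_big/=.
(* Count each ordered pair through the edge it spans. *)
transitivity (\sum_(p : 'I_n * 'I_n) \sum_(e in edges G) ([set p.1; p.2]%SET == e : nat))%N.
  apply: eq_bigr => p _; rewrite /adj; case: (boolP (_ \in edges G)) => pG.
    rewrite (bigD1 _ pG)/= eqxx big1// => e /andP[_ /negbTE ep].
    by rewrite eq_sym ep.
  by rewrite big1// => e eG; case: eqP pG => // ->; rewrite eG.
rewrite exchange_big/= mulnC -sum_nat_const; apply: eq_bigr => e eG.
have /forall_inP/(_ e eG)/cards2P[x [y [xy ->]]] := valP G.
rewrite (eq_bigr (fun p => (p \in [set (x, y); (y, x)]%SET) : nat)); last first.
  by move=> [i j] _; rewrite eq_set2.
by rewrite -big_mkcond sum1_card cards2 xpair_eqE (negbTE xy).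
Qed.

Lemma t_edge_graph_fun G : t_edge (graph_fun R G) = (2 * #|edges G|)%:R / n%:R ^+ 2.
Proof.
rewrite /t_edge; have [-> _] := Fubini_unit_square (bmeas_graph_fun G).
have b1 i : bmeas (\1_(cell i) : R -> R) := bmeas_indic R (measurable_cell i).
transitivity (E (fun x => \sum_i (\sum_j n%:R^-1 * (adj G i j)%:R) * \1_(cell i) x)).
  apply: eq_E01 => x _; under eq_E01 do rewrite graph_funE/=.
  rewrite E01_sum => [|i]; last first.
    apply: bmeasM; first exact: bmeas_cst.
    by apply: bmeas_sum => j; apply: bmeasM => //; exact: bmeas_cst.
  apply: eq_bigr => i _; rewrite E01Z; last first.
    by apply: bmeas_sum => j; apply: bmeasM => //; exact: bmeas_cst.
  rewrite mulrC E01_sum => [|j]; last by apply: bmeasM => //; exact: bmeas_cst.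
  congr (_ * _); apply: eq_bigr => j _.
  under eq_E01 do rewrite mulrC.
  by rewrite E01Z// E01_cell mulrC.
rewrite E01_sum => [|i]; last by apply: bmeasM => //; exact: bmeas_cst.
rewrite -card_adj natr_sum mulr_suml; apply: eq_bigr => i _.
rewrite E01Z// E01_cell natr_sum -mulr_sumr expr2 invfM mulrC mulrA.
by rewrite [in RHS]mulrC.
Qed.

(** The colours of the endpoints would have to change three times around a
    triangle. *)
Lemma bipartite_triangle_free G (s : pred 'I_n) : (forall i j, adj G i j -> s i != s j) ->
  forall x y z, graph_fun R G (x, y) * graph_fun R G (y, z) * graph_fun R G (z, x) = 0.
Proof.
move=> Gs x y z.
have edge (a b : R) : graph_fun R G (a, b) != 0 -> exists2 c : 'I_n * 'I_n,
    (a \in cell c.1) && (b \in cell c.2) & s c.1 != s c.2.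
  rewrite /graph_fun; case: existsP => [[i /existsP[j]]|]; last by rewrite eqxx.
  by rewrite !ceil_cell => /and3P[ai bj /Gs sij] _; exists (i, j); rewrite ?ai.
have uniq (a : R) i j : a \in cell i -> a \in cell j -> i = j.
  by rewrite -!ceil_cell => /eqP-> /eqP[] /val_inj.
apply/eqP/negPn/negP; rewrite !mulf_eq0 !negb_or => /andP[/andP[]].
move=> /edge[[i j]/= /andP[xi yj] sij] /edge[[j' k]/= /andP[yj' zk] sjk].
move=> /edge[[k' i']/= /andP[zk' xi'] ski].
move: sjk ski; rewrite (uniq _ _ _ yj' yj) (uniq _ _ _ zk' zk) (uniq _ _ _ xi' xi).
by move: sij; case: (s i); case: (s j); case: (s k).
Qed.

End graph_graphon.

Lemma t_triangle_eq0 (R : realType) (f : R * R -> R) :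
  (forall x y z, f (x, y) * f (y, z) * f (z, x) = 0) -> t_triangle f = 0.
Proof.
move=> f0; rewrite /t_triangle -[RHS](E01_cst 0); apply: eq_E01 => x _.
rewrite -[RHS](E01_cst 0); apply: eq_E01 => y _.
by rewrite -[RHS](E01_cst 0); apply: eq_E01.
Qed.

Lemma t_edgeZ (R : realType) (c : R) (f : R * R -> R) : bmeas f ->
  t_edge (fun p => c * f p) = c * t_edge f.
Proof.
move=> bf; rewrite /t_edge.
have [-> _] := Fubini_unit_square (bmeasM (bmeas_cst _ c) bf).
have [-> _] := Fubini_unit_square bf; rewrite -E01Z; last exact: bmeas_E01.
by apply: eq_E01 => x _; rewrite E01Z//; exact: (bmeas_comp (pair1_measurable x) bf).
Qed.

(** * Gibbs' inequality and the choice of parameters *)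

Section gibbs.
Variable R : realType.
Implicit Types (a b p q u v x y : R).

(** Concavity of the logarithm: ln (q / u) <= q / u - 1. *)
Lemma mul_lnB_le q u : 0 < q -> 0 <= u -> u * (ln q - ln u) <= q - u.
Proof.
move=> q0; rewrite le_eqVlt => /predU1P[<-|u0]; first by rewrite mul0r subr0 ltW.
rewrite -ln_div ?posrE//.
have -> : q - u = u * (q / u - 1) by rewrite mulrBr mulr1 mulrC divfK ?gt_eqF.
rewrite ler_pM2l//; have := @le_ln1Dx R (q / u - 1).
by rewrite [1 + _]addrC subrK; apply; rewrite ltrBrDr addNr divr_gt0.
Qed.

(** Relative entropy with respect to the law (p / (1 + p), 1 / (1 + p)) is
    nonnegative; the logarithmic inequality is applied to both atoms. *)
Lemma gibbs_le b u : 0 <= u <= 1 ->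
  b * u - entropy u <= 2^-1 * ln (1 + expR (2 * b)).
Proof.
move=> /andP[u0 u1]; set p := expR (2 * b).
have p0 : 0 < p := expR_gt0 _.
have Sp0 : 0 < 1 + p by rewrite addr_gt0.
have u1' : 0 <= 1 - u by rewrite subr_ge0.
have q1 : 0 < p / (1 + p) by rewrite divr_gt0.
have q2 : 0 < (1 + p)^-1 by rewrite invr_gt0.
have := mul_lnB_le q1 u0; have := mul_lnB_le q2 u1'.
rewrite ln_div ?posrE// lnV ?posrE// {2}/p expRK.
have -> : p / (1 + p) = 1 - (1 + p)^-1.
  by field; rewrite gt_eqF.
rewrite /entropy; move: (ln _) (ln u) (ln _) (_^-1) => L A B w.
lra.
Qed.

Lemma gibbs_eq b : let v := expR (2 * b) / (1 + expR (2 * b)) in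
  0 <= v <= 1 /\ b * v - entropy v = 2^-1 * ln (1 + expR (2 * b)).
Proof.
set p := expR (2 * b) => v.
have p0 : 0 < p := expR_gt0 _.
have Sp0 : 0 < 1 + p by rewrite addr_gt0.
split.
  apply/andP; split; first by rewrite divr_ge0 ?ltW.
  by rewrite ler_pdivrMr// mul1r lerDr.
have v1 : 1 - v = (1 + p)^-1 by rewrite /v; field; rewrite gt_eqF.
rewrite /entropy v1 lnV ?posrE// ln_div ?posrE// {1}/p expRK -v1.
by move: (ln _) => L; lra.
Qed.

(** ln (1 + p y) <= p y <= x once y = exp (- 2 a) is at most x / p; y <= 1 / 2
    makes a positive. *)
Lemma small_tilt p x : 0 < p -> 0 < x -> exists2 a, 0 < a &
  ln (1 + p * expR (- (2 * a))) <= x.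
Proof.
move=> p0 x0; pose y := Num.min (x / p) 2^-1.
have y0 : 0 < y by rewrite lt_min divr_gt0//= invr_gt0.
have y1 : y < 1 by rewrite gt_min invf_lt1// ltr1n orbT.
exists (- (2^-1 * ln y)); first by rewrite oppr_gt0 pmulr_rlt0 ?ln_lt0 ?y0// invr_gt0.
rewrite mulrN opprK mulVKf// lnK ?posrE//.
apply: le_trans (le_ln1Dx _) _; first by rewrite (lt_trans (ltrN10 _))// mulr_gt0.
by rewrite mulrC -ler_pdivlMr// ge_min lexx.
Qed.

(** Either a x <= d and the right-hand side is nonnegative, or x > d / a and the
    cubic term already beats a x. *)
Lemma cubic_le_linear a d b x : 0 < a -> 0 < d -> b < - (a ^+ 3 / d ^+ 2) -> 0 <= x ->
  b * x ^+ 3 <= d - a * x.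
Proof.
move=> a0 d0 ba x0; have C0 : 0 < a ^+ 3 / d ^+ 2 by rewrite divr_gt0 ?exprn_gt0.
have [axd|dax] := leP (a * x) d.
  by rewrite (@le_trans _ _ 0) ?subr_ge0// nmulr_rle0 ?exprn_ge0//; lra.
have xp : 0 < x by rewrite -(pmulr_rgt0 _ a0) (lt_trans d0).
have : a <= - b * x ^+ 2.
  rewrite (@le_trans _ _ (a ^+ 3 / d ^+ 2 * x ^+ 2))//; last first.
    by rewrite ler_pM2r ?exprn_gt0//; lra.
  rewrite mulrAC ler_pdivlMr ?exprn_gt0// (exprS a 2) -mulrA ler_pM2l// -exprMn.
  by rewrite ler_sqr ?nnegrE ?ltW// mulr_gt0.
move=> /(ler_wpM2r x0).
have -> : - b * x ^+ 2 * x = - (b * x ^+ 3) by ring.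
by lra.
Qed.

End gibbs.

(** * Generating functions of graphs by number of edges *)

Section generating_function.
Variable n : nat.
Implicit Types (G : simple_graph n) (B : {set {set 'I_n}}).

Definition vertex_pairs : {set {set 'I_n}} := [set e : {set 'I_n} | #|e| == 2%N].

Lemma edges_subset G : edges G \subset vertex_pairs.
Proof. by have /forall_inP Ge := valP G; apply/fintype.subsetP => e /Ge; rewrite inE. Qed.

(** Expand the product over T of (x + 1) on A and (0 + 1) elsewhere. *)
Lemma sum_subset_exp (R : comNzRingType) (T : finType) (A : {set T}) (x : R) :
  \sum_(S : {set T} | S \subset A) x ^+ #|S| = (1 + x) ^+ #|A|.
Proof.
have := @bigA_distr R 0 1 *%R +%R T (fun i => if i \in A then x else 0) (fun=> 1).
rewrite (bigID (mem A))/= [X in _ * X]big1 ?mulr1; last first.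
  by move=> i /negbTE->; rewrite add0r.
rewrite (eq_bigr (fun=> 1 + x)); last by move=> i ->; rewrite addrC.
rewrite prodr_const => ->; rewrite big_mkcond; apply: eq_big => [S|S _].
  by rewrite inE.
case: ifPn => [SA|/fintype.subsetPn[i iS iA]].
  rewrite -prodr_const big_mkcond; apply: eq_bigr => i _.
  by case: ifPn => // /(fintype.subsetP SA)->.
by rewrite (bigD1 i)//= iS (negbTE iA) mul0r.
Qed.

Lemma sum_graph_exp (R : comNzRingType) B (x : R) : B \subset vertex_pairs ->
  \sum_(G : simple_graph n | edges G \subset B) x ^+ #|edges G| = (1 + x) ^+ #|B|.
Proof.
move=> B2; rewrite -sum_subset_exp [RHS](reindex_omap (@edges n) insub) => [|S SB].
  by apply: eq_bigl => G; rewrite valK eqxx andbT.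
rewrite insubT//=; apply/forall_inP => e eS.
by have := fintype.subsetP (fintype.subset_trans SB B2) _ eS; rewrite inE.
Qed.

Lemma sum_all_graphs_exp (R : comNzRingType) (x : R) :
  \sum_(G : simple_graph n) x ^+ #|edges G| = (1 + x) ^+ 'C(n, 2).
Proof.
rewrite -[in RHS](card_ord n) -card_draws -sum_graph_exp//.
by apply: eq_bigl => G; rewrite edges_subset.
Qed.

Definition low_half : {set 'I_n} := [set i : 'I_n | (i < n./2)%N].

(** The edges of the balanced complete bipartite graph. *)
Definition cross_pairs : {set {set 'I_n}} :=
  [set [set p.1; p.2]%SET | p in finset.setX low_half (finset.setC low_half)].

Lemma low_high_neq i j : i \in low_half -> j \notin low_half -> i != j.
Proof. by move=> il; apply: contraNneq => <-. Qed.

Lemma cross_pairs_subset : cross_pairs \subset vertex_pairs.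
Proof.
apply/fintype.subsetP => _ /imsetP[[i j] + ->].
rewrite finset.in_setX finset.in_setC => /andP[il /(low_high_neq il) ij].
by rewrite inE cards2 ij.
Qed.

Lemma card_cross_pairs : (n ^ 2 <= 4 * #|cross_pairs| + 1)%N.
Proof.
rewrite (card_in_imset); last first.
  move=> [i j] [k l]; rewrite !finset.in_setX !finset.in_setC.
  move=> /andP[il jl] /andP[kl ll] /eqP.
  rewrite eq_set2 ?low_high_neq// in_set2 => /orP[/eqP//|/eqP[_ jk]].
  by rewrite jk kl in jl.
have lowE : #|low_half| = n./2.
  rewrite cardsE -sum1_card (eq_bigl (fun i : 'I_n => (i < n./2)%N)) //.
  by rewrite -(big_ord_widen _ (fun=> 1%N)) ?sum1_card ?card_ord//; lia.
have := finset.cardsC low_half; rewrite cardsX lowE card_ord => hn.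
have [n2|n2] : n = (n./2).*2 \/ n = (n./2).*2.+1 by lia.
all: move: hn n2; move: #|_| n./2 => c h hn n2; rewrite n2 in hn *; nia.
Qed.

Lemma cross_pairs_bipartite G i j : edges G \subset cross_pairs -> adj G i j ->
  (i < n./2)%N != (j < n./2)%N.
Proof.
move=> GB /(fintype.subsetP GB)/imsetP[[k l]].
rewrite finset.in_setX finset.in_setC => /andP[kl ll] /eqP.
rewrite eq_set2 ?low_high_neq// in_set2; move: kl ll; rewrite !inE/= => kl ll.
by case/orP => /eqP[-> ->]; rewrite kl (negbTE ll).
Qed.

End generating_function.

(** * The weight of graphs close to the constants *)

Section partition_function.
Variables (R : realType) (b1 b2 : R) (n : nat).
Hypothesis n_gt0 : (0 < n)%N.
Implicit Types G : simple_graph n.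

Definition graph_weight G : R := expR (n%:R ^+ 2 * T_stat b1 b2 (graph_fun R G)).

Lemma T_stat_graph G : n%:R ^+ 2 * T_stat b1 b2 (graph_fun R G) =
  2 * b1 * #|edges G|%:R + n%:R ^+ 2 * (b2 * t_triangle (graph_fun R G)).
Proof.
rewrite /T_stat t_edge_graph_fun// mulrDr; congr (_ + _).
have n0 : n%:R != 0 :> R by rewrite pnatr_eq0 -lt0n.
by move: #|_| => m; rewrite natrM; field.
Qed.

(** Keep only the graphs with all edges across the two halves: they have no
    triangle, and their weights sum to a binomial power. *)
Lemma partition_function_lb :
  (1 + expR (2 * b1)) ^+ #|cross_pairs n| <= \sum_G graph_weight G.
Proof.
rewrite -sum_graph_exp; last exact: cross_pairs_subset.
rewrite [leRHS](bigID (fun G => edges G \subset cross_pairs n))/=.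
rewrite -[leLHS]addr0 lerD//; last by apply: sumr_ge0 => G _; exact: expR_ge0.
apply: ler_sum => G GB; rewrite /graph_weight T_stat_graph.
rewrite t_triangle_eq0; last first.
  by apply: (bipartite_triangle_free n_gt0) => i j; exact: cross_pairs_bipartite.
by rewrite !mulr0 addr0 expRM_natr.
Qed.

(** The triangle penalty dominates a linear penalty in the number of edges:
    beta2 t^3 <= d - a t, where n^2 t is twice the number of edges. *)
Lemma near_constant_weight a d e G : 0 < a -> 0 < d -> 0 < e ->
    b2 < - (a ^+ 3 / d ^+ 2) ->
    delta_cut_set (tilde (graph_fun R G)) (constant_classes R) < e ->
  graph_weight G <= expR (n%:R ^+ 2 * (d - 12 * e * b2)) *
    (expR (2 * b1) * expR (- (2 * a))) ^+ #|edges G|.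
Proof.
move=> a0 d0 e0 ab Ge; rewrite /graph_weight T_stat_graph.
rewrite -expRD -expRM_natr -expRD ler_expR.
have gG := graphon_graph_fun R n_gt0 G.
have := near_constant_triangle_lb gG e0 Ge; have /andP[te0 _] := t_edge01 gG.
have := cubic_le_linear a0 d0 ab te0.
have n0 : n%:R != 0 :> R by rewrite pnatr_eq0 -lt0n.
have teE : 2 * #|edges G|%:R = n%:R ^+ 2 * t_edge (graph_fun R G).
  by rewrite t_edge_graph_fun// natrM; field.
have b20 : b2 < 0 by apply: lt_trans ab _; rewrite oppr_lt0 divr_gt0 ?exprn_gt0.
move: teE {te0}; move: (t_edge _) (t_triangle _) (#|_|%:R : R) => te t3 m teE h1 h2.
have N0 : 0 <= n%:R ^+ 2 :> R by rewrite exprn_ge0.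
move: (n%:R ^+ 2) teE N0 => N teE N0.
have h3 : b2 * t3 <= d - a * te - 12 * e * b2.
  have := ler_wnM2l (ltW b20) h2; lra.
have := ler_wpM2l N0 h3.
have -> : N * (d - a * te - 12 * e * b2) = N * (d - 12 * e * b2) - a * (N * te) by ring.
by rewrite -teE; lra.
Qed.

(** The numerator is at most exp (3 L n^2 / 32) since there are at most n^2 / 2
    pairs, and the denominator at least exp (L (n^2 - 1) / 4). *)
Lemma near_constant_ratio a d e : let L := ln (1 + expR (2 * b1)) in
    0 < a -> 0 < d -> 0 < e ->
    b2 < - (a ^+ 3 / d ^+ 2) ->
    ln (1 + expR (2 * b1) * expR (- (2 * a))) <= L / 16 ->
    d <= L / 32 -> - (12 * e * b2) <= L / 32 ->
  \sum_(G | delta_cut_set (tilde (graph_fun R G)) (constant_classes R) < e)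
     graph_weight G <=
  expR (L / 4 - 5 / 32 * L * n%:R ^+ 2) * \sum_G graph_weight G.
Proof.
move=> L a0 d0 e0 ab La Ld Le; set p := expR (2 * b1).
have p0 : 0 < p := expR_gt0 _.
set x := p * expR (- (2 * a)); have x0 : 0 < x by rewrite mulr_gt0// expR_gt0.
have L0 : 0 < L by rewrite ln_gt0// ltrDl.
apply: (@le_trans _ _ (expR (n%:R ^+ 2 * (L / 16)) * (1 + x) ^+ 'C(n, 2))).
  rewrite -sum_all_graphs_exp mulr_sumr [leRHS](bigID (fun G =>
    delta_cut_set (tilde (graph_fun R G)) (constant_classes R) < e))/=.
  rewrite -[leLHS]addr0 lerD//; last first.
    by apply: sumr_ge0 => G _; rewrite mulr_ge0 ?expR_ge0 ?exprn_ge0// ltW.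
  apply: ler_sum => G Ge; apply: le_trans (near_constant_weight a0 d0 e0 ab Ge) _.
  rewrite ler_wpM2r ?exprn_ge0 ?(ltW x0)// ler_expR ler_wpM2l ?exprn_ge0//.
  by move: L Ld Le {L0 La} => L; lra.
apply: (@le_trans _ _ (expR (L / 4 - 5 / 32 * L * n%:R ^+ 2) *
    (1 + p) ^+ #|cross_pairs n|)); last first.
  by rewrite ler_wpM2l ?expR_ge0// partition_function_lb.
have x1 : 1 + x = expR (ln (1 + x)) by rewrite lnK// posrE addr_gt0.
have p1 : 1 + p = expR L by rewrite lnK// posrE addr_gt0.
rewrite x1 p1 -!expRM_natr -!expRD ler_expR.
have hB : n%:R ^+ 2 <= 4 * #|cross_pairs n|%:R + 1 :> R.
  by rewrite -natrX -natrM -[X in _ + X]/(1%:R) -natrD ler_nat card_cross_pairs.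
have hC : 2 * 'C(n, 2)%:R <= n%:R ^+ 2 :> R.
  rewrite -natrX -natrM ler_nat bin2 mul2n.
  by have : ((n * n.-1)./2.*2 <= n * n.-1)%N; lia.
have C0 : 0 <= 'C(n, 2)%:R :> R by [].
move: (ln (1 + x)) La hB hC C0 => l La.
move: (#|_|%:R : R) ('C(n, 2)%:R : R) (n%:R ^+ 2 : R) => B C N hB hC C0.
move: L L0 La {Ld Le p1} => L L0 La.
have := ler_wpM2r C0 La; have := ler_wpM2l (ltW L0) hB; have := ler_wpM2l (ltW L0) hC.
lra.
Qed.

End partition_function.

(** * Constant and bipartite graphons *)

Section variational.
Variables (R : realType) (b1 b2 : R).
Local Notation D := (unit_interval R).

Lemma I_fun_cst (c : R) : D c -> I_fun (fun=> c) = entropy c.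
Proof.
move=> Dc; rewrite /I_fun; have [-> _] := Fubini_unit_square (bmeas_cst _ (entropy c)).
by rewrite E01_cst E01_cst.
Qed.

Lemma constant_value_ub a d (c : R) : 0 < a -> 0 < d -> b2 < - (a ^+ 3 / d ^+ 2) -> D c ->
  T_stat b1 b2 (fun=> c) - I_fun (fun=> c) <=
  2^-1 * ln (1 + expR (2 * b1) * expR (- (2 * a))) + d.
Proof.
move=> a0 d0 ab Dc; rewrite /T_stat t_edge_cst// t_triangle_cst I_fun_cst//.
have : 0 <= c <= 1 by move: Dc; rewrite /unit_interval/= in_itv.
move=> c01; have /andP[c0 _] := c01.
have := gibbs_le (b1 - a) c01; have := cubic_le_linear a0 d0 ab c0.
rewrite -expRD mulrBr; lra.
Qed.

Fact edge_graph_subproof :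
  [forall e in [set [set ord0; ord_max]]%SET : {set {set 'I_2}}, #|e| == 2%N].
Proof. by apply/forall_inP => e /set1P->; rewrite cards2. Qed.

(** Its graphon is 1 across the two halves of the unit interval and 0 inside
    them, up to a null set. *)
Definition edge_graph : simple_graph 2 := SimpleGraph edge_graph_subproof.

(** v g is 0 or v, so its entropy is that of v on a set of measure 1/2; what
    remains is half of the Gibbs optimum at beta1. *)
Lemma bipartite_value : exists2 h : R * R -> R, graphon R h &
  T_stat b1 b2 h - I_fun h = ln (1 + expR (2 * b1)) / 4.
Proof.
have [v01 vE] := gibbs_eq b1; move: v01 vE; set v := _ / _ => v01 vE.
have /andP[v0 v1] := v01; pose g := graph_fun R edge_graph.
have bg : bmeas g := bmeas_graph_fun R (isT : (0 < 2)%N) edge_graph.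
have tg : t_edge g = 2^-1.
  by rewrite /g t_edge_graph_fun// cards1 expr2; field.
exists (fun p => v * g p).
  have [mg g01 gC] := graphon_graph_fun R (isT : (0 < 2)%N) edge_graph; split.
  - by apply: measurable_funM.
  - move=> x y Dx Dy; have /andP[g0 g1] := g01 x y Dx Dy.
    by rewrite mulr_ge0//= -[leRHS]mulr1 ler_pM.
  - by move=> x y Dx Dy; rewrite /g gC.
rewrite /T_stat t_edgeZ// tg t_triangle_eq0; last first.
  move=> x y z; have -> : v * g (x, y) * (v * g (y, z)) * (v * g (z, x)) =
    v ^+ 3 * (g (x, y) * g (y, z) * g (z, x)) by ring.
  rewrite (bipartite_triangle_free (isT : (0 < 2)%N) (s := pred1 ord0)) ?mulr0//.
  move=> i j; rewrite /adj inE eq_set2// in_set2.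
  by case/orP => /eqP[-> ->].
have -> : I_fun (fun p => v * g p) = entropy v * 2^-1.
  rewrite -tg -t_edgeZ//; apply: eq_Rintegral => p _.
  rewrite /g /graph_fun; case: existsP => _; rewrite ?mulr1// !mulr0.
  by rewrite /entropy mulr0 mul0r subr0 ln1 mulr0 addr0.
move: vE; rewrite mulr0 addr0; lra.
Qed.

End variational.

(** * Convergence of probabilities *)

Section main.
Variable R : realType.

Lemma probability_preimage_le (d : measure_display) (T : measurableType d)
    (P : probability T R) (I : finType) (X : T -> I) (w : I -> R) (A : pred I) :
    (forall i, measurable (X @^-1` [set i]) /\ P (X @^-1` [set i]) = (w i)%:E) ->
  measurable [set t | A (X t)] /\ (P [set t | A (X t)] <= (\sum_(i | A i) w i)%:E)%E.
Proof.
move=> Xw.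
have unionE : [set t | A (X t)] = \big[setU/set0]_(i | A i) (X @^-1` [set i]).
  apply/seteqP; split => t /=.
    by move=> At; rewrite -bigcup_seq_cond/=; exists (X t); rewrite //= mem_index_enum.
  by rewrite -bigcup_seq_cond/= => -[i /andP[_ Ai] ->].
rewrite unionE; split; first by apply: bigsetU_measurable => i _; case: (Xw i).
have mX i := (Xw i).1; rewrite -sumEFin.
elim: (index_enum I) => [|i r IH]; first by rewrite !big_nil measure0.
rewrite !big_cons; case: ifP => // _; apply: le_trans (measureU2 _ _ _) _ => //.
  exact: bigsetU_measurable.
by rewrite -(Xw i).2 leeD2l.
Qed.

Lemma expR_sqr_cvg0 (a k : R) : 0 < k ->
  (expR (a - k * n%:R ^+ 2)) @[n --> \oo] --> (0 : R).
Proof.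
move=> k0.
apply: (@squeeze_cvgr _ _ _ _ (cst 0) (fun n => expR a * expR (- k) ^+ n)).
- apply: nearW => n; rewrite expR_ge0/= -expRM_natr -expRD ler_expR.
  rewrite lerD2l mulNr lerN2 ler_pM2l// -natrX ler_nat.
  by rewrite -mulnn; nia.
- exact: cvg_cst.
- rewrite -[X in _ --> X](mulr0 (expR a)); apply: cvgMr; apply: cvg_expr.
  by rewrite ger0_norm ?expR_ge0// expR_lt1 oppr_lt0.
Qed.

Lemma gibbs_probabilityE (b1 b2 : R) n (G : simple_graph n) : (0 < n)%N ->
  expR (n%:R ^+ 2 * (T_stat b1 b2 (graph_fun R G) - psi b1 b2 n)) =
  graph_weight b1 b2 G / \sum_(G : simple_graph n) graph_weight b1 b2 G.
Proof.
move=> n0; have n0' : n%:R != 0 :> R by rewrite pnatr_eq0 -lt0n.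
have Z0 : 0 < \sum_(G : simple_graph n) graph_weight b1 b2 G.
  apply: lt_le_trans (partition_function_lb b1 b2 n0).
  by rewrite exprn_gt0// addr_gt0// expR_gt0.
rewrite mulrBr /psi mulrA divff ?expf_neq0// mul1r expRD expRN lnK//.
Qed.

Lemma near_constant_probability_cvg (b1 b2 e L : R)
    (disp : nat -> measure_display) (Omega : forall n, measurableType (disp n))
    (P : forall n, probability (Omega n) R) (Gn : forall n, Omega n -> simple_graph n) :
    0 < L -> 0 < e ->
    (forall n, (0 < n)%N -> \sum_(G : simple_graph n |
      delta_cut_set (tilde (graph_fun R G)) (constant_classes R) < e)
        graph_weight b1 b2 G <=
      expR (L / 4 - 5 / 32 * L * n%:R ^+ 2) *
        \sum_(G : simple_graph n) graph_weight b1 b2 G) ->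
    (forall n (G : simple_graph n), measurable (Gn n @^-1` [set G]) /\
       P n (Gn n @^-1` [set G]) =
       (expR (n%:R ^+ 2 * (T_stat b1 b2 (graph_fun R G) - psi b1 b2 n)))%:E) ->
  P n [set w | e / 2 < delta_cut_set (tilde (graph_fun R (Gn n w))) (constant_classes R)]
    @[n --> \oo] --> 1%E.
Proof.
move=> L0 e0 ratio PG.
pose r n := expR (L / 4 - 5 / 32 * L * n%:R ^+ 2).
apply: (@squeeze_cvge _ _ _ _ (fun n => (1 - r n)%:E) _ (cst 1%E)); last exact: cvg_cst.
  exists 1%N => // n /= n0.
  have [mbad Pbad] := probability_preimage_le
    (fun G => ~~ (e / 2 < delta_cut_set (tilde (graph_fun R G))
       (constant_classes R))) (PG n).
  set bad := [set t | _] in mbad Pbad.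
  rewrite (_ : [set w | _] = ~` bad); last first.
    apply/seteqP; split => t; rewrite /bad/=.
      by move=> near_t; apply/negP; rewrite negbK.
    by move/negP; rewrite negbK.
  apply/andP; split; last by apply: probability_le1; exact: measurableC.
  rewrite probability_setC// EFinB.
  apply: leeB => //; apply: le_trans Pbad _; rewrite lee_fin.
  under eq_bigr do rewrite gibbs_probabilityE//.
  have Z0 : 0 < \sum_(G : simple_graph n) graph_weight b1 b2 G.
    apply: lt_le_trans (partition_function_lb b1 b2 n0).
    by rewrite exprn_gt0// addr_gt0// expR_gt0.
  rewrite -mulr_suml ler_pdivrMr//; apply: le_trans (ratio n n0).
  (* The complement of the event is that the distance is at most e / 2 < e. *)
  rewrite [leLHS]big_mkcond [leRHS]big_mkcond; apply: ler_sum => G _.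
  case: ifPn => [|_]; last by case: ifP => // _; exact: expR_ge0.
  rewrite -leNgt => /le_lt_trans->//.
  by rewrite ltr_pdivrMr// ltr_pMr// ltr1n.
apply: cvg_EFin; first exact: nearW.
rewrite -[X in _ --> X]subr0; apply: cvgB; first exact: cvg_cst.
by apply: expR_sqr_cvg0; rewrite !mulr_gt0.
Qed.

End main.

Theorem theorem6p3 (R : realType) (beta1 : R) :
  exists2 C : R, 0 < C & forall beta2 : R, beta2 < - C ->
    (forall c : R, unit_interval R c ->
       ~ (forall h : R * R -> R, graphon R h ->
            T_stat beta1 beta2 h - I_fun h
              <= T_stat beta1 beta2 (fun=> c) - I_fun (fun=> c)))
    /\
    (forall (d : nat -> measure_display)
            (Omega : forall n : nat, measurableType (d n))
            (P : forall n : nat, probability (Omega n) R)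
            (Gn : forall n : nat, Omega n -> simple_graph n),
       (forall (n : nat) (G : simple_graph n),
          measurable (Gn n @^-1` [set G]) /\
          P n (Gn n @^-1` [set G]) =
            (expR (n%:R ^+ 2 *
               (T_stat beta1 beta2 (graph_fun R G) - psi beta1 beta2 n)))%:E) ->
       exists2 eps : R, 0 < eps &
         P n [set w | eps < delta_cut_set (tilde (graph_fun R (Gn n w)))
                                          (constant_classes R)]
           @[n --> \oo] --> 1%E).
Proof.
set L := ln (1 + expR (2 * beta1)).
have L0 : 0 < L by rewrite ln_gt0// ltrDl expR_gt0.
have L16 : 0 < L / 16 by rewrite divr_gt0.
have [a a0 La] := small_tilt (expR_gt0 (2 * beta1)) L16.
have d0 : 0 < L / 32 by rewrite divr_gt0.
have C0 : 0 < a ^+ 3 / (L / 32) ^+ 2 by rewrite divr_gt0// exprn_gt0.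
exists (a ^+ 3 / (L / 32) ^+ 2) => // beta2 ab; split.
  move=> c Dc maxc; have [h gh hE] := bipartite_value beta1 beta2.
  have := le_trans (maxc h gh) (constant_value_ub beta1 a0 d0 ab Dc).
  rewrite hE -/L; move: La; move: (ln (1 + _ * _)) => x; move: L0; clear; lra.
move=> d Omega P Gn PG.
have b20 : beta2 < 0 by rewrite (lt_trans ab)// oppr_lt0.
(* 12 e |beta2| = L / 32. *)
pose e := L / (384 * - beta2).
have e0 : 0 < e by rewrite divr_gt0// mulr_gt0// oppr_gt0.
have eE : - (12 * e * beta2) <= L / 32.
  by rewrite le_eqVlt; apply/orP; left; apply/eqP; rewrite /e; field; rewrite lt_eqF.
exists (e / 2); first by rewrite divr_gt0.
apply: (near_constant_probability_cvg L0 e0 _ PG) => n n0.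
exact: near_constant_ratio n0 _ _ _ a0 d0 e0 ab La (lexx _) eE.
Qed.
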